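(* Let $n\geq 2$ and let $m\geq 2$ be an integer. Let $f\in L^{m/(m-1)}(\mathbb{R}^n)$ be a continuous nonnegative function with $f = f^{*_{\mathbf{e}}}$ for some $\mathbf{e}\in\mathbb{S}^{n-1}$, and assume that $$f(x) = h(x)\,(f*\cdots*f)(x)\quad\text{for all } x\in\mathbb{R}^n,$$ where the convolution product has $m$ factors and $h:\mathbb{R}^n\to(0,+\infty)$ is a continuous positive function. Then the set $\{x\in\mathbb{R}^n : f(x)>0\}$ is connected.
   Context: Symmetric-decreasing rearrangement: for a finite-measure set $A\subset\mathbb{R}^k$, $A^*$ is the centered open ball with the same measure; for measurable $u$ vanishing at infinity, $u^*(x)=\int_0^\infty\chi_{\{|u|>t\}^*}(x)\,dt$. Steiner symmetrization: with $x=(x_1,x')\in\mathbb{R}\times\mathbb{R}^{n-1}$, $u^{*_1}(x_1,x') := (u(x_1,\cdot))^*(x')$ (rearrangement in $\mathbb{R}^{n-1}$ for fixed $x_1$); for $\mathbf{e}\in\mathbb{S}^{n-1}$ pick $\mathsf{R}\in\mathrm{O}(n)$ with $\mathsf{R}\mathbf{e}=(1,0,\dots,0)$, $(\mathsf{R}u)(x)=u(\mathsf{R}^{-1}x)$, $u^{*_{\mathbf{e}}}:=\mathsf{R}^{-1}((\mathsf{R}u)^{*_1})$. *)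

(* Defs.v *)
From HB Require Import structures.
From mathcomp Require Import all_boot all_order all_algebra.
From mathcomp Require Import all_classical all_reals all_analysis.
Set Implicit Arguments. Unset Strict Implicit. Unset Printing Implicit Defensive.
Import Order.TTheory GRing.Theory Num.Theory.
Local Open Scope classical_set_scope.
Local Open Scope ring_scope.

(* Lebesgue (Borel) measure on R^k, realised as the k-fold product of   *)
(* the one-dimensional Lebesgue measure, transported to row vectors    *)
(* 'rV[R]_k through the coordinate bijection lp_coord.                 *)

Record lebpack (R : realType) (k : nat) := LebPack {
  lp_disp : measure_display;
  lp_type : measurableType lp_disp;
  lp_meas : {sigma_finite_measure set lp_type -> \bar R};
  lp_coord : lp_type -> 'rV[R]_k }.

(* the row vector (t, y_1, ..., y_k) *)
Definition vcons (R : realType) (k : nat) (t : R) (y : 'rV[R]_k) : 'rV[R]_k.+1 :=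
  \row_(i < k.+1) match unlift ord0 i with None => t | Some j => y ord0 j end.

Definition vtail (R : realType) (k : nat) (x : 'rV[R]_k.+1) : 'rV[R]_k :=
  \row_(j < k) x ord0 (lift ord0 j).

Definition vhead (R : realType) (k : nat) (x : 'rV[R]_k.+1) : R := x ord0 ord0.

(* product of two sigma-finite measures, packaged as a sigma-finite measure
   (the library's own instance is shadowed by another canonical instance) *)
Section lprod.
Local Open Scope ereal_scope.
Context d1 d2 (T1 : measurableType d1) (T2 : measurableType d2) (R : realType).
Variable m1 : {sigma_finite_measure set T1 -> \bar R}.
Variable m2 : {sigma_finite_measure set T2 -> \bar R}.

Definition lprod : set (T1 * T2) -> \bar R := (m1 \x m2)%E.

HB.instance Definition _ := Measure.on lprod.

Lemma lprod_sigma_finite : sigma_finite setT lprod.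
Proof.
have /sigma_finiteP[F [TF ndF Foo]] := sigma_finiteT m1.
have /sigma_finiteP[G [TG ndG Goo]] := sigma_finiteT m2.
exists (fun n => F n `*` G n).
 rewrite -setXTT TF TG predeqE => -[x y]; split.
    move=> [/= [n _ Fnx] [k _ Gky]]; exists (maxn n k) => //; split.
    - by move: x Fnx; exact/subsetPset/ndF/leq_maxl.
    - by move: y Gky; exact/subsetPset/ndG/leq_maxr.
  by move=> [n _ []/= ? ?]; split; exists n.
move=> k; have [? ?] := Foo k; have [? ?] := Goo k.
split; first exact: measurableX.
by rewrite /lprod product_measure1E// lte_mul_pinfty// ge0_fin_numE.
Qed.

HB.instance Definition _ := Measure_isSigmaFinite.Build _ _ _ lprod
  lprod_sigma_finite.

End lprod.

Fixpoint leb_pack (R : realType) (k : nat) : lebpack R k :=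
  match k with
  | 0 => @LebPack R 0 _ unit [the {sigma_finite_measure set unit -> \bar R} of @dirac _ unit tt R]
           (fun _ => 0)
  | k'.+1 =>
      let P := leb_pack R k' in
      @LebPack R k'.+1 _ (measurableTypeR R * lp_type P)%type
        (@lprod _ _ _ _ R (@lebesgue_measure R) (lp_meas P))
        (fun z => vcons z.1 (lp_coord z.2))
  end.

Definition lebn (R : realType) (k : nat) (A : set 'rV[R]_k) : \bar R :=
  lp_meas (leb_pack R k) (@lp_coord _ _ (leb_pack R k) @^-1` A).

Definition integn (R : realType) (k : nat) (g : 'rV[R]_k -> \bar R) : \bar R :=
  (\int[lp_meas (leb_pack R k)]_z g (@lp_coord _ _ (leb_pack R k) z))%E.

Definition enorm (R : realType) (k : nat) (x : 'rV[R]_k) : R :=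
  Num.sqrt (\sum_(i < k) x ord0 i ^+ 2).

Definition unit_sphere (R : realType) (k : nat) : set 'rV[R]_k :=
  [set e | enorm e = 1].

(* orthogonal matrices O(k); a matrix Q acts on row vectors by x |-> x *m Q^T,
   i.e. it is the usual action Q x on column vectors, transposed *)
Definition orthogonal_mx (R : realType) (k : nat) (Q : 'M[R]_k) : Prop :=
  Q^T *m Q = 1%:M.

Definition e1 (R : realType) (k : nat) : 'rV[R]_k.+1 := delta_mx ord0 ord0.

(* A^* : the centered open ball with the same measure as A
   (x belongs to A^* iff x lies in a centered open ball of measure |A|) *)
Definition sym_set (R : realType) (k : nat) (A : set 'rV[R]_k) : set 'rV[R]_k :=
  [set x | exists r : R, enorm x < r /\ lebn [set y : 'rV[R]_k | enorm y < r] = lebn A].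

Definition level_set (R : realType) (k : nat) (u : 'rV[R]_k -> R) (t : R) : set 'rV[R]_k :=
  [set y | t < `|u y|].

Definition vanishes_at_infinity (R : realType) (k : nat) (u : 'rV[R]_k -> R) : Prop :=
  forall t : R, 0 < t -> (lebn (level_set u t) < +oo)%E.

Definition sym_dec (R : realType) (k : nat) (u : 'rV[R]_k -> R) (x : 'rV[R]_k) : \bar R :=
  (\int[@lebesgue_measure R]_(t in [set t : R | (0 <= t)%R])
      (\1_(sym_set (level_set u t)) x)%:E)%E.

(* u^{*_1}(x_1, x') = (u(x_1, .))^*(x'), in dimension k+1 *)
Definition steiner1 (R : realType) (k : nat) (u : 'rV[R]_k.+1 -> R) (x : 'rV[R]_k.+1) : \bar R :=
  sym_dec (fun y : 'rV[R]_k => u (vcons (vhead x) y)) (vtail x).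

(* all the slices u(x_1, .) vanish at infinity (so that u^{*_1} is defined) *)
Definition slices_vanish (R : realType) (k : nat) (u : 'rV[R]_k.+1 -> R) : Prop :=
  forall t : R, vanishes_at_infinity (fun y : 'rV[R]_k => u (vcons t y)).

(* rotation of a function: (Q u)(x) = u(Q^{-1} x), with Q^{-1} x = x *m Q *)
Definition rotf (R : realType) (k : nat) (Q : 'M[R]_k) (u : 'rV[R]_k -> R) : 'rV[R]_k -> R :=
  fun x => u (x *m Q).

(* u^{*_e} = Q^{-1}((Q u)^{*_1}) where Q e = e_1 *)
Definition steinerQ (R : realType) (n : nat) : 'M[R]_n -> ('rV[R]_n -> R) -> 'rV[R]_n -> \bar R :=
  match n with
  | 0 => fun _ u x => (u x)%:E
  | k.+1 => fun Q u x => steiner1 (rotf Q u) (x *m Q^T)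
  end.

Definition steinerQ_defined (R : realType) (n : nat) : 'M[R]_n -> ('rV[R]_n -> R) -> Prop :=
  match n with
  | 0 => fun _ _ => True
  | k.+1 => fun Q u => slices_vanish (rotf Q u)
  end.

Definition rot_to_e1 (R : realType) (n : nat) : 'rV[R]_n -> 'M[R]_n -> Prop :=
  match n with
  | 0 => fun _ _ => False
  | k.+1 => fun e Q => orthogonal_mx Q /\ e *m Q^T = e1 R k
  end.

Definition conv (R : realType) (n : nat) (g1 g2 : 'rV[R]_n -> \bar R) (x : 'rV[R]_n) : \bar R :=
  integn (fun y : 'rV[R]_n => (g1 (x - y)%R * g2 y)%E).

(* convpow g k = g * g * ... * g  (k+1 factors) *)
Fixpoint convpow (R : realType) (n : nat) (g : 'rV[R]_n -> \bar R) (k : nat) : 'rV[R]_n -> \bar R :=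
  match k with
  | 0 => g
  | k'.+1 => conv g (convpow g k')
  end.

(* the m-fold convolution product f * ... * f (m factors, m >= 1) *)
Definition mconv (R : realType) (n : nat) (f : 'rV[R]_n -> R) (m : nat) : 'rV[R]_n -> \bar R :=
  convpow (fun x => (f x)%:E) m.-1.

(* f in L^p(R^n) (f continuous hence measurable): \int |f|^p < oo *)
Definition in_Lp (R : realType) (n : nat) (p : R) (f : 'rV[R]_n -> R) : Prop :=
  (integn (fun x => (`|f x| `^ p)%:E) < +oo)%E.

(* Main.v *)
Require Import Defs.
From HB Require Import structures.
From mathcomp Require Import all_boot all_order all_algebra.
From mathcomp Require Import all_classical all_reals all_analysis.
From mathcomp Require Import ring lra.
Set Implicit Arguments. Unset Strict Implicit. Unset Printing Implicit Defensive.
Import Order.TTheory GRing.Theory Num.Theory.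
Import numFieldNormedType.Exports.
Local Open Scope classical_set_scope.
Local Open Scope ring_scope.

(* By Steiner symmetry f does not decrease along the segment from a point x to
   its projection on the axis R e, so {f > 0} is connected as soon as its trace
   P := {p | f (p e) > 0} on the axis is an interval.  Since f, h > 0 and the
   m-fold convolution is positive exactly on the m-fold Minkowski sum of {f > 0}
   (f being continuous), and since projecting onto the axis commutes with sums,
   the open set P is its own m-fold sumset P + ... + P.  Such an open set of reals
   is an interval: it is stable under arbitrarily small translations in one
   direction, obtained from multiples of its own elements. *)

Section real_line.
Variable R : realType.
Implicit Types (P G : set R) (a d x y : R).

Lemma open_ball_sub P p : open P -> P p -> exists2 r, 0 < r & ball p r `<=` P.
Proof. by move=> Popen /Popen /nbhs_ballP[r r0 prP]; exists r. Qed.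

Lemma translation_closed_ge P a d : 0 < d ->
    (forall x, a <= x < a + d -> P x) -> (forall p, P p -> P (p + d)) ->
  forall x, a <= x -> P x.
Proof.
move=> d0 base Pd.
have strip k : forall x, a <= x < a + k%:R * d -> P x.
  elim: k => [|k IH] x /andP[ax xk]; first by move: xk; rewrite mul0r addr0; lra.
  have [xd|xd] := ltP x (a + d); first by apply: base; rewrite ax xd.
  rewrite -natr1 mulrDl mul1r in xk.
  by rewrite -(subrK d x); apply/Pd/IH/andP; split; lra.
move=> x ax; apply: (strip (Num.truncn ((x - a) / d)).+1); rewrite ax /=.
by have := truncnS_gt ((x - a) / d); rewrite ltr_pdivrMr //; lra.
Qed.

Lemma semigroup_small_gt0 G x y r :
    (forall a b, G a -> G b -> G (a + b)) -> 0 < x -> y < 0 -> 0 < r ->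
    ball x r `<=` G -> ball y r `<=` G ->
  forall eps, 0 < eps -> exists2 g, G g & 0 < g < eps.
Proof.
move=> GD x0 y0 r0 Gx Gy eps eps0.
have GMn N a : G a -> G (N.+1%:R * a).
  elim: N => [|N IH] Ga; first by rewrite mul1r.
  by rewrite -natr1 mulrDl mul1r; apply: GD => //; apply: IH.
(* [N x + L * ball y r] is a ball of radius [L r > x] centred in [(0, x]]. *)
pose L := (Num.truncn (x / r)).+1.
have xL : x < L%:R * r by have := truncnS_gt (x / r); rewrite ltr_pdivrMr.
pose N := (Num.truncn (- (L%:R * y) / x)).+1.
have N_gt : - (L%:R * y) < N%:R * x.
  by have := truncnS_gt (- (L%:R * y) / x); rewrite ltr_pdivrMr.
have N_le : (N%:R - 1) * x <= - (L%:R * y).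
  rewrite /N -natr1 addrK -ler_pdivlMr // truncn_le.
  by rewrite divr_ge0 ?oppr_ge0 ?mulr_ge0_le0 ?ltW.
have L0 : (0 : R) < L%:R by rewrite ltr0n.
set c := N%:R * x + L%:R * y.
have [t [t0 te tc]] : exists t, [/\ 0 < t, t < eps & t < c + L%:R * r].
  have [h|h] := lerP eps (c + L%:R * r);
    [exists (eps / 2) | exists ((c + L%:R * r) / 2)]; split; rewrite /c in h *; lra.
exists t; last by rewrite t0 te.
have -> : t = N%:R * x + L%:R * ((t - N%:R * x) / L%:R).
  by rewrite [L%:R * _]mulrC divfK ?gt_eqF // addrC subrK.
apply: GD; first by apply: GMn; apply: Gx; apply: ballxx.
apply: GMn; apply: Gy; rewrite /ball /= distrC.
have -> : (t - N%:R * x) / L%:R - y = (t - c) / L%:R.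
  by rewrite /c; field; rewrite gt_eqF.
rewrite normrM [X in _ * X]gtr0_norm ?invr_gt0 // ltr_pdivrMr //.
by rewrite ltr_norml; apply/andP; split; rewrite /c in tc *; nra.
Qed.

Section upward_closed.
Variables (M : R) (P : set R).
Hypotheses (M_ge1 : 1 <= M) (P_open : open P)
  (P_addM : forall p q, P p -> P q -> P (p + M * q))
  (P_low : forall p, P p -> exists2 q, P q & (M + 1) * q <= p).

Let G := [set d | forall p, P p -> P (p + d)].

Let GD a b : G a -> G b -> G (a + b).
Proof. by move=> Ga Gb p Pp; rewrite addrA; apply/Gb/Ga. Qed.

Let GM q : P q -> G (M * q).
Proof. by move=> Pq p Pp; apply: P_addM. Qed.

Let M_gt0 : 0 < M. Proof. exact: lt_le_trans ltr01 M_ge1. Qed.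

Let G_ball q r : 0 < r -> ball q r `<=` P -> ball (M * q) (M * r) `<=` G.
Proof.
move=> r0 qrP z qz; rewrite -(divfK (lt0r_neq0 M_gt0) z) mulrC; apply/GM/qrP.
rewrite /ball /= in qz *.
have -> : q - z / M = (M * q - z) / M by field; rewrite gt_eqF.
by rewrite normrM [X in _ * X]gtr0_norm ?invr_gt0 // ltr_pdivrMr // [r * M]mulrC.
Qed.

Let P_gt0_of_ge0 p : (forall q, P q -> 0 <= q) -> P p -> 0 < p.
Proof.
move=> P_ge0 Pp; have [r r0 prP] := open_ball_sub P_open Pp.
have : P (p - r / 2) by apply: prP; rewrite /ball /= opprB addrC subrK gtr0_norm; lra.
by move/P_ge0; lra.
Qed.

(* Since [P] lies in [(0, +oo)], iterating [P_low] halves elements of [P]. *)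
Let P_small (u : R) : (forall q, P q -> 0 < q) -> P u ->
  forall eps, 0 < eps -> exists2 q, P q & q < eps.
Proof.
move=> P_gt0 Pu eps eps0.
have shrink j : exists2 q, P q & j.+1%:R * q <= u.
  elim: j => [|j [q Pq qu]]; first by exists u; rewrite ?mul1r.
  have [q' Pq' q'q] := P_low Pq; exists q' => //.
  have q'0 := P_gt0 _ Pq'.
  have q'2 : 2 * q' <= q by move: M_ge1 q'q; nra.
  have J1 : (1 : R) <= j.+1%:R by rewrite ler1n.
  rewrite -[j.+2%:R]natr1; nra.
have [q Pq qu] := shrink (Num.truncn (u / eps)); exists q => //.
have := truncnS_gt (u / eps); rewrite ltr_pdivrMr // => /(le_lt_trans qu).
by rewrite ltr_pM2l // ltr0n.
Qed.

Let small_translations : (exists2 u, P u & 0 < u) ->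
  forall eps, 0 < eps -> exists2 d, G d & 0 < d < eps.
Proof.
move=> [u Pu u0] eps eps0.
have [[v [Pv v0]]|noneg] := pselect (exists v, P v /\ v < 0).
  have [r1 r10 uP] := open_ball_sub P_open Pu.
  have [r2 r20 vP] := open_ball_sub P_open Pv.
  pose r := Num.min r1 r2; have r0 : 0 < r by rewrite lt_min r10 r20.
  apply: (@semigroup_small_gt0 _ (M * u) (M * v) (M * r)) => //.
  - exact: mulr_gt0.
  - by rewrite pmulr_rlt0.
  - exact: mulr_gt0.
  - by apply: G_ball => //; apply: subset_trans uP; apply: le_ball; rewrite ge_min lexx.
  - by apply: G_ball => //; apply: subset_trans vP; apply: le_ball; rewrite ge_min lexx orbT.
have P_gt0 q : P q -> 0 < q.
  apply: P_gt0_of_ge0 => {}q Pq; rewrite leNgt; apply/negP => q0.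
  by apply: noneg; exists q.
have [q Pq qe] := P_small P_gt0 Pu (divr_gt0 eps0 M_gt0).
exists (M * q); first exact: GM.
by rewrite mulr_gt0 ?(P_gt0 q) //= mulrC -ltr_pdivlMr.
Qed.

Lemma sumset_upward_closed : (exists2 u, P u & 0 < u) ->
  forall a x, P a -> a <= x -> P x.
Proof.
move=> Ppos a x Pa; have [r r0 arP] := open_ball_sub P_open Pa.
have [d Gd /andP[d0 dr]] := small_translations Ppos r0.
apply: (translation_closed_ge d0 _ Gd) => z /andP[az zd]; apply: arP.
by rewrite /ball /= ler0_norm; lra.
Qed.

End upward_closed.

Lemma sumset_is_interval (M : R) (P : set R) : 1 <= M -> open P ->
    (forall p q, P p -> P q -> P (p + M * q)) ->
    (forall p, P p -> exists2 q, P q & (M + 1) * q <= p) ->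
    (forall p, P p -> exists2 q, P q & p <= (M + 1) * q) ->
  is_interval P.
Proof.
move=> M1 Popen PaddM Plow Phigh a c Pa Pc b /andP[ab bc].
have [c0|c0] := ltP 0 c.
  by apply: (sumset_upward_closed M1 Popen PaddM Plow _ Pa ab); exists c.
pose P' := [set z | P (- z)].
have P'open : open P' by apply: open_comp => // z _; apply: oppr_continuous.
have P'addM p q : P' p -> P' q -> P' (p + M * q).
  by rewrite /P' /= opprD -mulrN; apply: PaddM.
have P'low p : P' p -> exists2 q, P' q & (M + 1) * q <= p.
  by move=> /Phigh[q Pq pq]; exists (- q); rewrite /P' /= ?opprK // mulrN lerNl.
have [r r0 crP] := open_ball_sub Popen Pc.
have P'pos : exists2 u, P' u & 0 < u.
  exists (r / 2 - c); last lra.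
  by apply: crP; rewrite /ball /= opprK addrC subrK gtr0_norm; lra.
rewrite -[b]opprK; apply: (sumset_upward_closed M1 P'open P'addM P'low P'pos (a := - c)).
  by rewrite /P' /= opprK.
by rewrite lerN2.
Qed.

End real_line.

Lemma connected_through (T : topologicalType) (S A : set T) :
    connected A -> A `<=` S ->
    (forall x, S x -> exists C, [/\ connected C, C `<=` S, C x & C `&` A !=set0]) ->
  connected S.
Proof.
move=> Aconn AS SC.
have [[x0 Sx0]|noS] := pselect (exists x, S x); last first.
  suff -> : S = set0 by exact: connected0.
  by apply/seteqP; split => // x Sx; apply: noS; exists x.
pose I := [set C | [/\ connected C, C `<=` S & C `&` A !=set0]].
have -> : S = \bigcup_(C in I) (C `|` A).
  apply/seteqP; split => [x /SC[C [Cconn CS Cx CA]]|x [C [_ CS _] [/CS|/AS]]] //.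
  by exists C; [split|left].
apply: bigcup_connected => [|C [Cconn _ CA]]; last exact: connectedU.
have [_ [_ _ _ [a [_ Aa]]]] := SC _ Sx0.
by exists a => C _; right.
Qed.

Section nonneg_integral.
Local Open Scope ereal_scope.
Context d (T : measurableType d) (R : realType) (mu : {measure set T -> \bar R}).

Lemma ge0_le_integral_nonmeas (D : set T) (f1 f2 : T -> \bar R) :
    (forall x, D x -> 0 <= f1 x) -> (forall x, D x -> f1 x <= f2 x) ->
  \int[mu]_(x in D) f1 x <= \int[mu]_(x in D) f2 x.
Proof.
move=> f10 f12; rewrite (ge0_integralE _ f10) ge0_integralE; last first.
  by move=> x Dx; apply: le_trans (f10 x Dx) (f12 x Dx).
apply: le_ereal_sup => _ [g gf <-]; exists g => //= x.
exact: le_trans (gf x) (lee_restrict f12 x).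
Qed.

Lemma integral_gt0_ex (D : set T) (f : T -> \bar R) :
  0 < \int[mu]_(x in D) f x -> exists2 x, D x & f x != 0.
Proof.
apply: contraPP => /forall2NP f0; rewrite integral0_eq ?ltxx // => x Dx.
by have [//|/negP/negbNE/eqP] := f0 x.
Qed.

End nonneg_integral.

Section rows.
Variable R : realType.

Lemma vcons0 k t (y : 'rV[R]_k) : vcons t y ord0 ord0 = t.
Proof. by rewrite /vcons mxE unlift_none. Qed.

Lemma vhead_vcons k t (y : 'rV[R]_k) : vhead (vcons t y) = t.
Proof. exact: vcons0. Qed.

Lemma vcons_lift k t (y : 'rV[R]_k) j : vcons t y ord0 (lift ord0 j) = y ord0 j.
Proof. by rewrite /vcons mxE liftK. Qed.

Lemma vtail_vcons k t (y : 'rV[R]_k) : vtail (vcons t y) = y.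
Proof. by apply/rowP => j; rewrite /vtail mxE vcons_lift. Qed.

Lemma vheadB k (x y : 'rV[R]_k.+1) : vhead (x - y) = vhead x - vhead y.
Proof. by rewrite /vhead !mxE. Qed.

Lemma vheadZe1 k p : vhead (p *: e1 R k) = p.
Proof. by rewrite /vhead /e1 !mxE eqxx mulr1. Qed.

Lemma shrink_to_e1_axis k (w : 'rV[R]_k.+1) t :
  vhead w *: e1 R k + t *: (w - vhead w *: e1 R k) = vcons (vhead w) (t *: vtail w).
Proof.
apply/rowP => i; rewrite /vcons /e1 /vtail !mxE.
have -> : (0 : 'I_1) = ord0 by apply/val_inj.
case: (unliftP ord0 i) => [j ->|->]; rewrite ?mxE.
  by rewrite eqxx [lift _ _ == _]eq_sym (negbTE (neq_lift _ _)) /= mulr0 add0r subr0.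
by rewrite eqxx /vhead mulr1; ring.
Qed.

Lemma enorm_scale_le k (z : 'rV[R]_k) t : 0 <= t <= 1 -> enorm (t *: z) <= enorm z.
Proof.
move=> /andP[t0 t1]; rewrite /enorm ler_sqrt; last first.
  by apply: sumr_ge0 => i _; exact: sqr_ge0.
apply: ler_sum => i _; rewrite mxE exprMn.
have : t ^+ 2 <= 1 by rewrite expr_le1.
by have := sqr_ge0 (z ord0 i); move: (z ord0 i ^+ 2) => a; nra.
Qed.

Lemma sym_dec_enorm_antitone k (u : 'rV[R]_k -> R) z z' :
  enorm z' <= enorm z -> (sym_dec u z <= sym_dec u z')%E.
Proof.
move=> zz'; apply: ge0_le_integral_nonmeas => t _; first by rewrite lee_fin indicE.
rewrite lee_fin !indicE.
have [/set_mem [r [zr Br]]|_] := boolP (z \in _); last by case: (_ \in _).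
by rewrite mem_set //; exists r; split => //; exact: le_lt_trans zz' zr.
Qed.

Lemma steiner1_shrink k (u : 'rV[R]_k.+1 -> R) t y c : 0 <= c <= 1 ->
  (steiner1 u (vcons t y) <= steiner1 u (vcons t (c *: y)))%E.
Proof.
move=> c01; rewrite /steiner1 !vhead_vcons !vtail_vcons.
by rewrite sym_dec_enorm_antitone // enorm_scale_le.
Qed.

Lemma ball_rowP k (z w : 'rV[R]_k) r :
  ball z r w <-> 0 < r /\ forall j, `|z ord0 j - w ord0 j| < r.
Proof.
split=> -[r0 zw]; split=> //.
  by move=> j; exact: zw ord0 j.
by move=> i j; rewrite (ord1 i); exact: zw j.
Qed.

Lemma lp_meas_ball_ge k (z : 'rV[R]_k) r : 0 < r ->
  measurable (@lp_coord _ _ (leb_pack R k) @^-1` ball z r) /\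
  exists2 v : R, 0 < v &
    (v%:E <= lp_meas (leb_pack R k) (@lp_coord _ _ (leb_pack R k) @^-1` ball z r))%E.
Proof.
move=> r0; elim: k z => [|k IH] z.
  have -> : @lp_coord _ _ (leb_pack R 0) @^-1` ball z r = setT.
    by apply/seteqP; split => // x _; apply/ball_rowP; split => // -[].
  by split => //; exists 1 => //=; rewrite diracT.
have [mB [v v0 Bv]] := IH (vtail z).
(* balls of row vectors are sup-norm balls, hence products of balls *)
have -> : @lp_coord _ _ (leb_pack R k.+1) @^-1` ball z r =
    ball (vhead z) r `*` (@lp_coord _ _ (leb_pack R k) @^-1` ball (vtail z) r).
  apply/seteqP; split => -[t w] /=.
    move/ball_rowP => [_ zw]; split; first by have := zw ord0; rewrite vcons0.
    by apply/ball_rowP; split => // j; have := zw (lift ord0 j); rewrite vcons_lift mxE.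
  move=> [zt /ball_rowP [_ zw]]; apply/ball_rowP; split => // j.
  have [j' ->|->] := unliftP ord0 j; first by rewrite vcons_lift; have := zw j'; rewrite mxE.
  by rewrite vcons0.
have mI : measurable (ball (vhead z) r : set R) by rewrite ball_itv; exact: measurable_itv.
split; first exact: measurableX.
exists ((r *+ 2) * v); first by rewrite mulr_gt0 // mulrn_wgt0.
rewrite /= /lprod product_measure1E // ball_itv EFinM.
have I2r : lebesgue_measure (`](vhead z - r), (vhead z + r)[%classic : set R) = (r *+ 2)%:E.
  rewrite lebesgue_measure_itv /= lte_fin ltrBlDr -addrA ltrDl addr_gt0 // -EFinB.
  by congr (_%:E); lra.
set I := (X in (_ <= X * _)%E); have -> : I = (r *+ 2)%:E := I2r.
by apply: lee_wpmul2l => //; rewrite lee_fin mulrn_wge0 // ltW.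
Qed.

End rows.

Section convolution.
Variables (R : realType) (n : nat).
Local Notation V := 'rV[R]_n.
Implicit Types G : V -> \bar R.

Definition lb_near_pos G := forall z, (0 < G z)%E ->
  exists c r : R, [/\ 0 < c, 0 < r & forall z', ball z r z' -> (c%:E <= G z')%E].

Variables G1 G2 : V -> \bar R.
Hypotheses (G1_ge0 : forall z, (0 <= G1 z)%E) (G2_ge0 : forall z, (0 <= G2 z)%E).

Lemma conv_ge0 x : (0 <= Defs.conv G1 G2 x)%E.
Proof. by apply: integral_ge0 => z _; apply: mule_ge0. Qed.

Lemma conv_gt0_ex x : (0 < Defs.conv G1 G2 x)%E ->
  exists y, (0 < G1 (x - y))%E /\ (0 < G2 y)%E.
Proof.
move=> /integral_gt0_ex[w _]; rewrite mule_eq0 negb_or => /andP[G1w G2w].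
by exists (@lp_coord _ _ (leb_pack R n) w); rewrite !lt0e G1w G2w G1_ge0 G2_ge0.
Qed.

Hypotheses (G1_lb : lb_near_pos G1) (G2_lb : lb_near_pos G2).

(* If [G1 >= c1] on [ball (x - y) r1] and [G2 >= c2] on [ball y r2], then for [x']
   near [x] the integrand of the convolution at [x'] is [>= c1 c2] on a ball around [y]. *)
Let conv_lb_at x y : (0 < G1 (x - y))%E -> (0 < G2 y)%E ->
  exists c r : R, [/\ 0 < c, 0 < r & forall x', ball x r x' -> (c%:E <= Defs.conv G1 G2 x')%E].
Proof.
move=> /G1_lb[c1 [r1 [c10 r10 G1c]]] /G2_lb[c2 [r2 [c20 r20 G2c]]].
pose m := Num.min r1 r2; pose rho := m / 2.
have m0 : 0 < m by rewrite lt_min r10 r20.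
have [mr1 mr2] : m <= r1 /\ m <= r2 by rewrite !ge_min !lexx orbT.
have rho0 : 0 < rho by rewrite /rho; lra.
have rho_r1 : rho + rho <= r1 by rewrite /rho; lra.
have rho_r2 : rho <= r2 by rewrite /rho; lra.
have [mB [v v0 Bv]] := lp_meas_ball_ge y rho0.
exists (c1 * c2 * v), rho; split => [||x' xx']; rewrite ?mulr_gt0 //.
set B := (X in lp_meas _ X) in Bv mB.
apply: (@le_trans _ _ ((c1 * c2)%:E * lp_meas (leb_pack R n) B)%E).
  by rewrite EFinM lee_wpmul2l // lee_fin mulr_ge0 // ltW.
rewrite -(setIT B) -integral_indic // -(integralZl_indic measurableT (fun=> B)) //; last first.
  by move=> h; exfalso; move: h; rewrite ltNge mulr_ge0 // ltW.
apply: ge0_le_integral_nonmeas => w _; first by rewrite lee_fin mulr_ge0 // ?ltW ?mulr_gt0.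
rewrite indicE; have [/set_mem yw|_] := boolP (w \in B); last by rewrite mulr0 mule_ge0.
rewrite mulr1 EFinM lee_pmul ?lee_fin ?(ltW c10) ?(ltW c20) //.
  apply: G1c; move/ball_rowP: yw => [_ yw]; move/ball_rowP: xx' => [_ xx'].
  apply/ball_rowP; split; first by rewrite (lt_le_trans _ rho_r1) // addr_gt0.
  move=> j; have := yw j; have := xx' j; rewrite !mxE.
  set a := x ord0 j; set b := x' ord0 j; set yy := y ord0 j; set ww := lp_coord _ ord0 j.
  have := ler_normD (a - b) (ww - yy).
  have -> : a - yy - (b - ww) = (a - b) + (ww - yy) by ring.
  by rewrite (distrC yy ww); lra.
apply: G2c; move/ball_rowP: yw => [_ yw]; apply/ball_rowP; split => // j.
exact: lt_le_trans (yw j) rho_r2.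
Qed.

Lemma conv_gt0P x : (0 < Defs.conv G1 G2 x)%E <->
  exists y, (0 < G1 (x - y))%E /\ (0 < G2 y)%E.
Proof.
split; first exact: conv_gt0_ex.
move=> [y [G1xy G2y]]; have [c [r [c0 r0 convc]]] := conv_lb_at G1xy G2y.
by apply: lt_le_trans (convc x (ballxx x r0)); rewrite lte_fin.
Qed.

Lemma conv_lb_near_pos : lb_near_pos (Defs.conv G1 G2).
Proof. by move=> x /conv_gt0_ex[y [G1xy G2y]]; exact: conv_lb_at G1xy G2y. Qed.

End convolution.

Section steiner_symmetric_solution.
Variables (R : realType) (n : nat).
Local Notation V := 'rV[R]_n.+1.
Variables (f h : V -> R) (Q : 'M[R]_n.+1) (e : V) (k : nat).
Hypotheses (f_cont : continuous f) (f_ge0 : forall x, 0 <= f x).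
Hypothesis Qe : e *m Q^T = e1 R n.
Hypothesis f_steiner : forall x, (f x)%:E = steiner1 (rotf Q f) (x *m Q^T).
Hypothesis h_gt0 : forall x, 0 < h x.
Hypothesis f_eq : forall x, (f x)%:E = ((h x)%:E * convpow (fun x => (f x)%:E) k.+1 x)%E.

Local Notation F := (fun x => (f x)%:E).

(* the coordinate of [x] along the symmetry axis [R e] *)
Let ecoord (x : V) := vhead (x *m Q^T).

Let ecoordB x y : ecoord (x - y) = ecoord x - ecoord y.
Proof. by rewrite /ecoord mulmxBl vheadB. Qed.

Let ecoordZe p : ecoord (p *: e) = p.
Proof. by rewrite /ecoord -scalemxAl Qe vheadZe1. Qed.

Lemma f_le_toward_axis x t : 0 <= t <= 1 ->
  f x <= f (ecoord x *: e + t *: (x - ecoord x *: e)).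
Proof.
move=> t01; rewrite -lee_fin !f_steiner.
have -> : (ecoord x *: e + t *: (x - ecoord x *: e)) *m Q^T =
    vcons (ecoord x) (t *: vtail (x *m Q^T)).
  by rewrite mulmxDl -!scalemxAl mulmxBl -scalemxAl Qe; exact: shrink_to_e1_axis.
have {1}-> : x *m Q^T = vcons (ecoord x) (vtail (x *m Q^T)).
  by have := shrink_to_e1_axis (x *m Q^T) 1; rewrite scale1r addrC subrK scale1r.
exact: steiner1_shrink.
Qed.

Lemma f_le_axis x : f x <= f (ecoord x *: e).
Proof. by have := @f_le_toward_axis x 0; rewrite scale0r addr0; apply; rewrite lexx ler01. Qed.

Lemma F_lb_near_pos : lb_near_pos F.
Proof.
move=> z; rewrite lte_fin => fz.
have fz2 : f z / 2 < f z by lra.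
have fz_cont : {for z, continuous f} by apply: f_cont.
have /(_ _)/nbhs_ballP[r r0 zr] := cvgr_gt (f z) fz_cont _ fz2.
by exists (f z / 2), r; split => // [|z' /zr /ltW]; rewrite ?lee_fin //; lra.
Qed.

Lemma convpow_ge0 j x : (0 <= convpow F j x)%E.
Proof. by elim: j x => [|j IH] x; [rewrite lee_fin | exact: conv_ge0]. Qed.

Lemma convpow_lb_near_pos j : lb_near_pos (convpow F j).
Proof.
elim: j => [|j IH]; first exact: F_lb_near_pos.
by apply: (conv_lb_near_pos _ (@convpow_ge0 j) F_lb_near_pos IH) => x; rewrite lee_fin.
Qed.

Lemma convpowS_gt0P j x : (0 < convpow F j.+1 x)%E <->
  exists y, 0 < f (x - y) /\ (0 < convpow F j y)%E.
Proof.
have F_ge0 z : (0 <= F z)%E by rewrite lee_fin.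
rewrite (conv_gt0P F_ge0 (@convpow_ge0 j) F_lb_near_pos (@convpow_lb_near_pos j)).
by split=> -[y [fxy Gy]]; exists y; rewrite ?lte_fin in fxy *.
Qed.

Lemma convpow_gt0_axis j x :
  (0 < convpow F j x)%E -> (0 < convpow F j (ecoord x *: e))%E.
Proof.
elim: j x => [|j IH] x.
  by rewrite /= !lte_fin => /lt_le_trans; apply; exact: f_le_axis.
move/convpowS_gt0P => [y [fxy Gy]]; apply/convpowS_gt0P; exists (ecoord y *: e).
by rewrite -scalerBl -ecoordB; split; [exact: lt_le_trans fxy (f_le_axis _) | exact: IH].
Qed.

Let A j := [set p : R | (0 < convpow F j (p *: e))%E].

Lemma axis_convpowS_gt0P j p : A j.+1 p <-> exists2 q, A 0 q & A j (p - q).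
Proof.
split => [/convpowS_gt0P[y [fpy Gy]]|[q Aq Apq]].
  exists (ecoord (p *: e - y)).
    by rewrite /A /= lte_fin; exact: lt_le_trans fpy (f_le_axis _).
  by rewrite ecoordB ecoordZe opprB addrC subrK; apply: convpow_gt0_axis.
apply/convpowS_gt0P; exists ((p - q) *: e); split => //.
by rewrite -scalerBl opprB addrC subrK; rewrite /A /= lte_fin in Aq.
Qed.

Lemma axis_mul j q : A 0 q -> A j (j.+1%:R * q).
Proof.
move=> Aq; elim: j => [|j IH]; first by rewrite mul1r.
by apply/axis_convpowS_gt0P; exists q; rewrite // -[j.+2%:R]natr1 mulrDl mul1r addrK.
Qed.

Lemma axis_bounds j r : A j r ->
  (exists2 q, A 0 q & j.+1%:R * q <= r) /\ (exists2 q, A 0 q & r <= j.+1%:R * q).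
Proof.
elim: j r => [|j IH] r; first by split; exists r; rewrite ?mul1r.
move=> /axis_convpowS_gt0P[p Ap /IH[[q1 Aq1 lo] [q2 Aq2 hi]]].
have J0 : (0 : R) <= j.+1%:R by [].
rewrite -[j.+2%:R]natr1; split.
  by have [pq|pq] := lerP p q1; [exists p | exists q1] => //; nra.
by have [pq|pq] := lerP q2 p; [exists p | exists q2] => //; nra.
Qed.

Lemma axis_fixed p : A 0 p <-> A k.+1 p.
Proof.
change ((0 < (f (p *: e))%:E)%E <-> (0 < convpow F k.+1 (p *: e))%E).
rewrite f_eq; have := @convpow_ge0 k.+1 (p *: e).
move: (convpow F k.+1 (p *: e)) => G G0; split => [hG|G_gt0].
  by rewrite lt0e G0 andbT; apply: contraTneq hG => ->; rewrite mule0 ltxx.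
by apply: mule_gt0; rewrite ?lte_fin ?h_gt0.
Qed.

Let scale_e_continuous : continuous (fun q : R => q *: e).
Proof. by move=> q; apply: cvgZr_tmp; exact: cvg_id. Qed.

Lemma axis_open : open (A 0).
Proof.
have -> : A 0 = (fun p : R => f (p *: e)) @^-1` [set x | 0 < x].
  by apply/seteqP; split => p; rewrite /A /= lte_fin.
apply: open_comp; last exact: open_gt.
by move=> p _; apply: continuous_comp; [exact: scale_e_continuous | exact: f_cont].
Qed.

Lemma axis_is_interval : is_interval (A 0).
Proof.
apply: (@sumset_is_interval _ k.+1%:R); rewrite ?ler1n //; first exact: axis_open.
- move=> p q Ap Aq; apply/axis_fixed/axis_convpowS_gt0P; exists p => //.
  by rewrite (addrC p) addrK; exact: axis_mul.
- by move=> p /axis_fixed/axis_bounds[[q Aq qp] _]; exists q; rewrite // natr1.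
- by move=> p /axis_fixed/axis_bounds[_ [q Aq qp]]; exists q; rewrite // natr1.
Qed.

Lemma f_gt0_connected : connected [set x | 0 < f x].
Proof.
apply: (@connected_through _ _ ((fun p => p *: e) @` A 0)).
- apply: connected_continuous_connected; last exact: continuous_subspaceT.
  exact/connected_intervalP/axis_is_interval.
- by move=> _ [p Ap <-]; rewrite /A /= lte_fin in Ap.
move=> x fx; pose g t := ecoord x *: e + t *: (x - ecoord x *: e).
exists (g @` `[0, 1]%classic); split.
- apply: connected_continuous_connected; last apply: continuous_subspaceT.
    by apply/connected_intervalP; exact: interval_is_interval.
  by move=> t; apply: cvgD; [exact: cvg_cst | apply: cvgZr_tmp; exact: cvg_id].
- move=> _ [t t01 <-]; apply: lt_le_trans fx (f_le_toward_axis _ _).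
  by move: t01; rewrite /= in_itv.
- by exists 1; rewrite /= ?in_itv /= ?lexx ?ler01 // /g scale1r addrC subrK.
exists (ecoord x *: e); split.
  by exists 0; rewrite /= ?in_itv /= ?lexx ?ler01 // /g scale0r addr0.
exists (ecoord x) => //; rewrite /A /= lte_fin; exact: lt_le_trans fx (f_le_axis x).
Qed.

End steiner_symmetric_solution.

Unset Implicit Arguments.

Theorem lemma4p2 (R : realType) (n : nat) (hn : (2 <= n)%N) (m : nat) (hm : (2 <= m)%N)
    (f h : 'rV[R]_n -> R) :
  continuous f ->
  (forall x, 0 <= f x) ->
  in_Lp (m%:R / (m%:R - 1)) f ->
  (exists e : 'rV[R]_n, unit_sphere e /\
     exists Q : 'M[R]_n, rot_to_e1 e Q /\ steinerQ_defined Q f /\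
       (forall x, (f x)%:E = steinerQ Q f x)) ->
  continuous h ->
  (forall x, 0 < h x) ->
  (forall x, (f x)%:E = ((h x)%:E * mconv f m x)%E) ->
  connected [set x | 0 < f x].
Proof.
case: n hn f h => [//|n] _ f h; case: m hm => [//|[//|k]] _.
move=> f_cont f_ge0 _ [e [_ [Q [[_ Qe] [_ f_steiner]]]]] _ h_gt0 f_eq.
exact: (f_gt0_connected f_cont f_ge0 Qe f_steiner h_gt0 f_eq).
Qed.
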